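(* Let $k\le n$ be positive integers and $w\in\mathcal{W}_{n,k}$. Let $w\circledast 1 \in \mathcal{W}_{n+1,k}$ be the word obtained by appending to the end of $w$ the letter $w_{i_m}$, where $i_m$ is the largest initial position of $w$. Then $\mathfrak{S}_{w\circledast 1} = \mathfrak{S}_w$ as polynomials.
   Context: $\mathcal{W}_{n,k}$ is the set of words $w = w_1\cdots w_n\in[k]^n$ in which each of $1,\dots,k$ appears. A position $j$ is initial in $w$ if $w_{j'}\neq w_j$ for all $j'<j$. Schubert polynomials for words: $\mathfrak{S}_\pi$ for $\pi\in S_N$ is the classical Schubert polynomial ($\mathfrak{S}_{w_0}=x_1^{N-1}\cdots x_{N-1}$, $\mathfrak{S}_{\pi s_i}=\partial_i\mathfrak{S}_\pi$ if $\pi(i)>\pi(i+1)$, where $\partial_i f=(f-s_if)/(x_i-x_{i+1})$). $S_n$ acts on polynomials by $\pi.x_i = x_{\pi(i)}$. For $w\in[k]^n$ with $m$ distinct letters, $\mathrm{std}(w)\in S_{n+k-m}$ keeps letters in initial positions, replaces letters in non-initial positions from left to right by $k+1,\dots,k+n-m$, and appends the letters of $[k]$ missing from $w$ in increasing order. $\mathrm{conv}(w)$ is the unique word with no subword $i\cdots j\cdots i$ ($i\neq j$) having the same letter multiplicities as $w$ and the same left-to-right order of initial letters. If the initial letters of $w$ are $a_1,\dots,a_m$ left to right, $\sigma(w)\in S_n$ has one-line notation listing the positions of the occurrences of $a_1$ in increasing order, then of $a_2$, etc. Then $\mathfrak{S}_w := \sigma(w)^{-1}.\mathfrak{S}_{\mathrm{std}(\mathrm{conv}(w))}$.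 *)

(* Defs.v *)
From HB Require Import structures.
From mathcomp Require Import all_boot all_order all_fingroup all_algebra.
From mathcomp Require Import ring zify.
From mathcomp.multinomials Require Import mpoly.

Set Implicit Arguments.
Unset Strict Implicit.
Unset Printing Implicit Defensive.

Import GRing.Theory.
Local Open Scope ring_scope.

Fact leibniz_subproof (R : comNzRingType) (d a b sa sb g1 g2 : R) :
  d * g1 = a - sa -> d * g2 = b - sb ->
  d * (g1 * b + sa * g2) = a * b - sa * sb.
Proof.
move=> e1 e2; rewrite mulrDr mulrA e1 mulrCA e2.
by rewrite mulrBl mulrBr addrA subrK.
Qed.

Fact comm_subproof (R : comNzRingType) (A I D g sg f tf sf stf : R) :
  A * D = g - sg -> I * g = f - tf -> I * sg = sf - stf ->
  I * (A * D) = f - sf - tf + stf.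
Proof. by move=> -> e1 e2; rewrite mulrBr e1 e2; ring. Qed.

Fact braid_subproof (R : comNzRingType)
    (A B C D g sg h th sth f sf tf tsf stf stsf : R) :
  C = A + B -> A * D = g - sg -> B * g = h - th -> C * sg = h - sth ->
  C * th = tf - tsf -> B * sth = stf - stsf -> A * h = f - sf ->
  C * (B * (A * D)) = f - sf - tf + tsf + stf - stsf.
Proof.
move=> eC -> e1 e2 e3 e4 e5.
transitivity (C * (B * g) - B * (C * sg)); first by ring.
rewrite e1 e2; transitivity (A * h - C * th + B * sth).
  by rewrite eC; ring.
by rewrite e3 e4 e5; ring.
Qed.

Section DividedDifference.
Variable N : nat.
Implicit Types (f g : {mpoly int[N]}) (i j l : 'I_N).

Lemma msymXU (s : 'S_N) l : msym s 'X_l = 'X_(s l) :> {mpoly int[N]}.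
Proof. by rewrite /msym mmapX mmap1U. Qed.

Lemma ddiff_exists i j f :
  exists g, ('X_i - 'X_j) * g == f - msym (tperm i j) f.
Proof.
pose P h := exists g, ('X_i - 'X_j) * g = h - msym (tperm i j) h.
have P1 : P 1 by exists 0; rewrite msym1 subrr mulr0.
have PM h1 h2 : P h1 -> P h2 -> P (h1 * h2).
  move=> [g1 e1] [g2 e2]; exists (g1 * h2 + msym (tperm i j) h1 * g2).
  by rewrite msymM; apply: leibniz_subproof.
have PX l : P 'X_l.
  rewrite /P msymXU; case: tpermP => [->|->|_ _].
  - by exists 1; rewrite mulr1.
  - by exists (-1); rewrite mulrN1 opprB.
  - by exists 0; rewrite mulr0 subrr.
suff [g e] : P f by exists g; apply/eqP.
elim/mpolyind: f => [|c m p _ _ [g e]].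
  by exists 0; rewrite msym0 subrr mulr0.
have [h eh] : P 'X_[m].
  rewrite mpolyXE_id; elim/big_ind: _ => // l _.
  by elim: (m l) => [|d IH]; rewrite ?expr0 // exprS; apply: PM.
exists (c *: h + g).
by rewrite mulrDr -scalerAr eh e msymD msymZ scalerBr opprD addrACA.
Qed.

(* The quotient (f - s_ij f) / (x_i - x_j) in Z[x_1, ..., x_N]; it is unique
   for i != j because the ring is a domain. *)
Definition ddiff i j f : {mpoly int[N]} := xchoose (ddiff_exists i j f).

Lemma ddiffP i j f : ('X_i - 'X_j) * ddiff i j f = f - msym (tperm i j) f.
Proof. exact/eqP/(xchooseP (ddiff_exists i j f)). Qed.

#[local] Opaque ddiff.

Lemma subXU_neq0 i j : i != j -> 'X_i - 'X_j != 0 :> {mpoly int[N]}.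
Proof.
move=> ij; rewrite subr_eq0; apply/eqP => /(congr1 (mcoeff U_(i))).
rewrite !mcoeffXU eqxx eq_sym (negPf ij) => /eqP.
by rewrite oner_eq0.
Qed.

Lemma ddiff_uniq i j f g : i != j ->
  ('X_i - 'X_j) * g = f - msym (tperm i j) f -> g = ddiff i j f.
Proof. by move=> ij; rewrite -ddiffP => /(mulfI (subXU_neq0 ij)). Qed.

Lemma ddiff_sym i j f : i != j -> msym (tperm i j) (ddiff i j f) = ddiff i j f.
Proof.
move=> ij; apply: ddiff_uniq => //.
have := congr1 (msym (tperm i j)) (ddiffP i j f).
rewrite msymM !msymB !msymXU tpermL tpermR -msymMm tperm2 msym1m => /eqP.
by rewrite -eqr_opp -mulNr !opprB => /eqP.
Qed.

Lemma ddiff_comm a b i j f : a != b -> i != j ->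
  a != i -> a != j -> b != i -> b != j ->
  ddiff a b (ddiff i j f) = ddiff i j (ddiff a b f).
Proof.
have key a' b' i' j' h : a' != i' -> a' != j' -> b' != i' -> b' != j' ->
    ('X_i' - 'X_j') * (('X_a' - 'X_b') * ddiff a' b' (ddiff i' j' h)) =
    h - msym (tperm a' b') h - msym (tperm i' j') h
      + msym (tperm a' b') (msym (tperm i' j') h).
  move=> ai aj bi bj; apply: comm_subproof (ddiffP _ _ _) (ddiffP _ _ _) _.
  have := congr1 (msym (tperm a' b')) (ddiffP i' j' h).
  by rewrite msymM !msymB !msymXU !tpermD.
move=> ab ij ai aj bi bj.
apply/(mulfI (subXU_neq0 ab))/(mulfI (subXU_neq0 ij)).
have K1 := key a b i j f ai aj bi bj.
have [ia ja ib jb] : [/\ i != a, j != a, i != b & j != b].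
  by split; rewrite eq_sym.
have K2 := key i j a b f ia ib ja jb.
have C : (tperm a b * tperm i j = tperm i j * tperm a b)%g.
  rewrite conjgC; congr (_ * _)%g.
  by rewrite tpermJ !tpermD // eq_sym.
rewrite [LHS]K1 [RHS]mulrCA [RHS]K2 -!msymMm C.
exact: (congr1 (fun z => z + _) (addrAC _ _ _)).
Qed.

Lemma ddiff_braid a b c f : a != b -> b != c -> a != c ->
  ddiff a b (ddiff b c (ddiff a b f)) = ddiff b c (ddiff a b (ddiff b c f)).
Proof.
move=> ab bc ac.
set s := tperm a b; set t := tperm b c.
have sa : s a = b by rewrite tpermL.
have sb : s b = a by rewrite tpermR.
have sc : s c = c by rewrite tpermD // eq_sym.
have ta : t a = a by rewrite tpermD // eq_sym.
have tb : t b = c by rewrite tpermL.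
have tc : t c = b by rewrite tpermR.
have sts : (s * t * s = t * s * t)%g.
  apply/permP => x; rewrite !permM.
  have [->|xa] := eqVneq x a; first by rewrite sa tb sc ta sa tb.
  have [->|xb] := eqVneq x b; first by rewrite sb ta sa tb sc tc.
  have [->|xc] := eqVneq x c; first by rewrite sc tc sb ta.
  by rewrite !tpermD // eq_sym.
have hs : msym s (ddiff a b f) = ddiff a b f by exact: ddiff_sym.
have ht : msym t (ddiff b c f) = ddiff b c f by exact: ddiff_sym.
have es p : ('X_a - 'X_b) * ddiff a b p = p - msym s p by exact: ddiffP.
have et p : ('X_b - 'X_c) * ddiff b c p = p - msym t p by exact: ddiffP.
apply/(mulfI (subXU_neq0 ab))/(mulfI (subXU_neq0 bc))/(mulfI (subXU_neq0 ac)).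
have L : ('X_a - 'X_c) * (('X_b - 'X_c) * (('X_a - 'X_b) *
    ddiff a b (ddiff b c (ddiff a b f)))) =
  f - msym s f - msym t f + msym t (msym s f) + msym s (msym t f)
    - msym s (msym t (msym s f)).
  have e2 := congr1 (msym t) (es f).
  rewrite msymM !msymB !msymXU ta tb in e2.
  have e3 := congr1 (msym s) e2.
  rewrite msymM !msymB !msymXU sa sc in e3.
  apply: braid_subproof (es _) (et _) _ e2 e3 (es _).
    by rewrite addrA subrK.
  have := congr1 (msym s) (et (ddiff a b f)).
  rewrite msymM !msymB !msymXU sb sc => ->.
  exact: (congr1 (fun z => z - _) hs).
have R : ('X_a - 'X_c) * (('X_a - 'X_b) * (('X_b - 'X_c) *
    ddiff b c (ddiff a b (ddiff b c f)))) =
  f - msym t f - msym s f + msym s (msym t f) + msym t (msym s f)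
    - msym t (msym s (msym t f)).
  have e2 := congr1 (msym s) (et f).
  rewrite msymM !msymB !msymXU sb sc in e2.
  have e3 := congr1 (msym t) e2.
  rewrite msymM !msymB !msymXU ta tc in e3.
  apply: braid_subproof (et _) (es _) _ e2 e3 (et _).
    by rewrite [RHS]addrC addrA subrK.
  have := congr1 (msym t) (es (ddiff b c f)).
  rewrite msymM !msymB !msymXU ta tb => ->.
  exact: (congr1 (fun z => z - _) ht).
rewrite [LHS]L [('X_b - 'X_c) * (('X_a - 'X_b) * _)]mulrCA [RHS]R -!msymMm sts.
apply: (congr1 (fun z => z - _)); rewrite addrAC.
exact: (congr1 (fun z => z + _ + _) (addrAC _ _ _)).
Qed.

End DividedDifference.

#[global] Opaque ddiff.

Section Schubert.
Variable N : nat.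
Implicit Types (p : 'S_N) (i j : 'I_N).

Definition w0 : 'S_N := perm (@rev_ord_inj N).

Definition staircase : {mpoly int[N]} := \prod_(i < N) 'X_i ^+ (N.-1 - i).

Definition ascent p : pred ('I_N * 'I_N) :=
  fun ij => (ij.2 == ij.1.+1 :> nat) && (p ij.1 < p ij.2)%N.

(* (tperm i j * p) x = p (tperm i j x), i.e. the product p s_i of functions. *)
Fixpoint schubert_rec (fuel : nat) p : {mpoly int[N]} :=
  if fuel is fuel'.+1 then
    if [pick ij | ascent p ij] is Some (i, j)
    then ddiff i j (schubert_rec fuel' (tperm i j * p)%g)
    else staircase
  else staircase.

(* Each step p -> p s_i removes one of the at most N * N pairs of positions
   in increasing order, so the fuel does not run out; schubert_w0 and
   schubert_desc below are the usual characterization, in which the descent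
   is arbitrary. *)
Definition schubert p : {mpoly int[N]} := schubert_rec (N * N) p.

Definition noninv p :=
  [set ij : 'I_N * 'I_N | (ij.1 < ij.2)%N && (p ij.1 < p ij.2)%N].

Lemma card_noninv_lt p i j : ascent p (i, j) ->
  (#|noninv (tperm i j * p)%g| < #|noninv p|)%N.
Proof.
case/andP => /= /eqP ij pij.
pose h (ab : 'I_N * 'I_N) := (tperm i j ab.1, tperm i j ab.2).
have hh : cancel h h by case=> a b; rewrite /h /= !tpermK.
rewrite -(card_imset _ (can_inj hh)); apply: proper_card.
apply/properP; split.
  apply/subsetP => c /imsetP[[a b]]; rewrite inE /= !permM => /andP[ab pab] ->.
  rewrite inE /h /= pab andbT.
  have V (x y : 'I_N) : x <> y -> nat_of_ord x <> y by move=> xy /val_inj.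
  move: pab; case: tpermP => [ea|ea|/V na1 /V na2];
    case: tpermP => [eb|eb|/V nb1 /V nb2]; subst; lia.
exists (i, j); first by rewrite inE /= pij andbT ij.
apply/imsetP => -[[a b]]; rewrite !inE /= => /andP[ab _] [ei ej].
by move: ab; rewrite -(tpermK i j a) -ei tpermL -(tpermK i j b) -ej tpermR; lia.
Qed.

Lemma schubert_rec_pick n p :
  schubert_rec n.+1 p = if [pick ij | ascent p ij] is Some (i, j)
    then ddiff i j (schubert_rec n (tperm i j * p)%g) else staircase.
Proof. exact: erefl. Qed.

Lemma schubert_recS n p :
  (#|noninv p| <= n)%N -> schubert_rec n p = schubert_rec n.+1 p.
Proof.
elim: n p => [|n IH] p le.
  rewrite schubert_rec_pick.
  case: pickP => [[i j] /card_noninv_lt|_]; last exact: erefl.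
  by rewrite ltnNge (leq_trans le).
rewrite !(schubert_rec_pick _ p).
case: pickP => [[i j] /card_noninv_lt lt|_]; last exact: erefl.
by apply: (congr1 (ddiff i j)); apply: IH; rewrite -ltnS (leq_trans lt).
Qed.

Lemma schubert_recE n p : (#|noninv p| <= n)%N -> schubert_rec n p = schubert p.
Proof.
have H m k : (#|noninv p| <= m)%N -> schubert_rec (m + k) p = schubert_rec m p.
  move=> le; elim: k => [|k IH]; first by rewrite addn0.
  by rewrite addnS -schubert_recS // (leq_trans le) // leq_addr.
move=> le; have le2 : (#|noninv p| <= N * N)%N.
  by rewrite (leq_trans (max_card _)) // card_prod !card_ord.
by rewrite -(H n (N * N)%N) // addnC H.
Qed.

Lemma schubert_pick p :
  schubert p = if [pick ij | ascent p ij] is Some (i, j)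
               then ddiff i j (schubert (tperm i j * p)%g) else staircase.
Proof.
rewrite -(schubert_recE (leqnSn #|noninv p|)) schubert_rec_pick.
case: pickP => [[i j] /card_noninv_lt lt|_]; last exact: erefl.
by apply: (congr1 (ddiff i j)); apply: schubert_recE; apply: ltnW.
Qed.

#[local] Opaque schubert.

Lemma w0E i : w0 i = rev_ord i. Proof. by rewrite permE. Qed.

Lemma schubert_w0 : schubert w0 = staircase.
Proof.
rewrite schubert_pick; case: pickP => [[i j]|_]; last exact: erefl.
move=> /andP[/= /eqP ij].
by rewrite !w0E /= ij; have := ltn_ord j; lia.
Qed.

Lemma ascent_tperm p i j a b : ascent p (i, j) -> ascent p (a, b) ->
  i != a -> i != b -> j != a -> ascent (tperm i j * p)%g (a, b).
Proof.
move=> /andP[/= /eqP ij pij] /andP[/= /eqP ab pab] ia ib ja.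
have jb : j != b by move: ia; rewrite -!val_eqE /=; lia.
by rewrite /ascent /= !permM !tpermD // ab eqxx.
Qed.

Lemma schubert_asc p i j : ascent p (i, j) ->
  schubert p = ddiff i j (schubert (tperm i j * p)%g).
Proof.
have [m] := ubnP #|noninv p|; elim: m p i j => // m IH p i j ltm aij.
rewrite schubert_pick; case: pickP => [[a b] aab|/(_ (i, j))]; last by rewrite aij.
have IHs q : (#|noninv q| < #|noninv p|)%N -> forall i j, ascent q (i, j) ->
    schubert q = ddiff i j (schubert (tperm i j * q)%g).
  by move=> lt i' j'; apply: IH; apply: leq_trans lt _.
move: {IH ltm} IHs i j a b aij aab.
suff H : (forall q, (#|noninv q| < #|noninv p|)%N -> forall i j, ascent q (i, j) ->
    schubert q = ddiff i j (schubert (tperm i j * q)%g)) ->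
  forall i j a b, ascent p (i, j) -> ascent p (a, b) -> (i <= a)%N ->
  ddiff a b (schubert (tperm a b * p)%g) = ddiff i j (schubert (tperm i j * p)%g).
  move=> IHs i j a b aij aab; case/orP: (leq_total i a) => le; first exact: H.
  by apply/esym/H.
move=> IHs i j a b aij aab le.
have [/= /eqP ij pij] := andP aij; have [/= /eqP ab pab] := andP aab.
have ij' : i != j by rewrite -val_eqE /= ij; lia.
have ab' : a != b by rewrite -val_eqE /= ab; lia.
have lti := card_noninv_lt aij; have lta := card_noninv_lt aab.
have [ia|ia] := eqVneq i a.
  by have -> : b = j; [apply: val_inj; rewrite /= ab ij ia | rewrite ia].
have ib : i != b by move: ia; rewrite -!val_eqE /=; lia.
have [ja|ja] := eqVneq j a; last first.
  have jb : j != b by move: ia; rewrite -!val_eqE /=; lia.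
  have ai : ascent (tperm i j * p)%g (a, b) by apply: ascent_tperm.
  have aa : ascent (tperm a b * p)%g (i, j).
    by apply: ascent_tperm => //; rewrite eq_sym.
  rewrite (IHs _ lti _ _ ai) (IHs _ lta _ _ aa) !mulgA.
  have -> : (tperm i j * tperm a b = tperm a b * tperm i j)%g.
    by rewrite conjgC; congr (_ * _)%g; rewrite tpermJ !tpermD // eq_sym.
  by apply: ddiff_comm => //; rewrite eq_sym.
subst a.
have bi : b != i by rewrite eq_sym.
have ji : j != i by rewrite eq_sym.
have bj : b != j by rewrite eq_sym.
have sb : tperm i j b = b by rewrite tpermD.
have ti : tperm j b i = i by rewrite tpermD.
have pib := ltn_trans pij pab.
have A1 : ascent (tperm i j * p)%g (j, b).
  by rewrite /ascent /= !permM tpermR sb ab eqxx.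
have A2 : ascent (tperm j b * (tperm i j * p))%g (i, j).
  by rewrite /ascent /= !permM ti tpermL tpermL sb ij eqxx.
have B1 : ascent (tperm j b * p)%g (i, j).
  by rewrite /ascent /= !permM tpermL ti ij eqxx.
have B2 : ascent (tperm i j * (tperm j b * p))%g (j, b).
  by rewrite /ascent /= !permM tpermR sb ti tpermR ab eqxx.
have E1 := IHs _ (ltn_trans (card_noninv_lt A1) lti) _ _ A2.
have E2 := IHs _ (ltn_trans (card_noninv_lt B1) lta) _ _ B2.
rewrite [in RHS](IHs _ lti _ _ A1) [in RHS]E1.
rewrite [in LHS](IHs _ lta _ _ B1) [in LHS]E2.
have -> : (tperm i j * (tperm j b * (tperm i j * p)) =
           tperm j b * (tperm i j * (tperm j b * p)))%g.
  rewrite !mulgA; congr (_ * p)%g.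
  rewrite -[in LHS]mulgA -{1}(tpermV i j) -conjgE tpermJ tpermR sb.
  rewrite -[in RHS]mulgA -{1}(tpermV j b) -conjgE tpermJ ti tpermL.
  by [].
by apply/esym/ddiff_braid.
Qed.

(* The recursion in the usual form: if p(i) > p(i+1) then
   S_(p s_i) = d_i S_p. *)
Lemma schubert_desc p i j : j = i.+1 :> nat -> (p j < p i)%N ->
  schubert (tperm i j * p)%g = ddiff i j (schubert p).
Proof.
move=> ij lt; rewrite (@schubert_asc _ i j) ?mulgA ?tperm2 ?mul1g //.
by rewrite /ascent /= !permM tpermL tpermR ij eqxx.
Qed.

End Schubert.

#[global] Opaque schubert.

Section Words.
Variables n k : nat.
Implicit Types (w v : n.-tuple 'I_k) (j : 'I_n).

(* Letters, positions and variables are numbered from 0. *)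

Definition fubini : {set n.-tuple 'I_k} :=
  [set w : n.-tuple 'I_k | [forall a : 'I_k, a \in w]].

Definition initial w j :=
  [forall j' : 'I_n, (j' < j)%N ==> (tnth w j' != tnth w j)].

Definition initials w : seq 'I_k :=
  [seq tnth w j | j <- enum 'I_n & initial w j].

Definition nletters w := size (undup w).

Lemma initialP w j :
  reflect (forall j' : 'I_n, (j' < j)%N -> tnth w j' <> tnth w j) (initial w j).
Proof.
apply: (iffP forallP) => H j'; first by move=> lt; apply/eqP/(implyP (H j')).
by apply/implyP => lt; apply/eqP/H.
Qed.

Lemma initial_inj w : {in initial w &, injective (tnth w)}.
Proof.
move=> i j /initialP ii /initialP ij e; apply: val_inj.
by case: (ltngtP i j) => // lt; [case: (ij _ lt) | case: (ii _ lt)].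
Qed.

Lemma first_occ w j :
  exists2 i : 'I_n, initial w i & (tnth w i = tnth w j) /\ (i <= j)%N.
Proof.
have [i /eqP ei min] := @arg_minnP _ j (fun i => tnth w i == tnth w j) val (eqxx _).
exists i; last by split=> //; apply: min.
by apply/initialP => j' lt e; have := min j'; rewrite e ei eqxx /= => /(_ isT); lia.
Qed.

Lemma initials_uniq w : uniq (initials w).
Proof.
rewrite map_inj_in_uniq 1?filter_uniq ?enum_uniq // => i j.
by rewrite !mem_filter => /andP[ii _] /andP[ij _]; apply: initial_inj.
Qed.

Lemma mem_initials w : initials w =i w.
Proof.
move=> a; apply/mapP/tnthP => [[j _ ->]|[j ->]]; first by exists j.
have [i ii [<- _]] := first_occ w j.
by exists i; rewrite // mem_filter ii mem_enum.
Qed.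

Lemma size_initials w : size (initials w) = nletters w.
Proof.
apply/perm_size/uniq_perm; rewrite ?initials_uniq ?undup_uniq // => a.
by rewrite mem_undup mem_initials.
Qed.

Lemma nletters_le_k w : (nletters w <= k)%N.
Proof.
by rewrite /nletters -[leqRHS]card_ord -(card_uniqP (undup_uniq w)) max_card.
Qed.

Lemma nletters_le_n w : (nletters w <= n)%N.
Proof. by rewrite -[leqRHS](size_tuple w) size_undup. Qed.

Definition std_size w := (n + k - nletters w)%N.

Lemma leq_std_size w : (n <= std_size w)%N.
Proof. by rewrite /std_size; have := nletters_le_k w; lia. Qed.

Definition std_letter w j : nat :=
  if initial w j then nat_of_ord (tnth w j)
  else (k + #|[set j' : 'I_n | (j' < j)%N && ~~ initial w j']|)%N.

Definition std_seq w : seq nat :=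
  [seq std_letter w j | j <- enum 'I_n] ++
  [seq nat_of_ord a | a <- enum 'I_k & a \notin w].

Lemma card_initial w : #|[set j | initial w j]| = nletters w.
Proof.
rewrite -size_initials size_map cardE; apply/perm_size/uniq_perm.
- exact: enum_uniq.
- by rewrite filter_uniq // enum_uniq.
- by move=> j; rewrite [RHS]mem_filter !mem_enum inE andbT.
Qed.

Lemma size_std_seq w : size (std_seq w) = std_size w.
Proof.
rewrite size_cat !size_map -enumT size_enum_ord size_filter.
have C : count (mem w) (enum 'I_k) = nletters w.
  rewrite -size_filter; apply/perm_size/uniq_perm.
  - by rewrite filter_uniq // enum_uniq.
  - exact: undup_uniq.
  - by move=> a; rewrite mem_filter mem_undup mem_enum andbT.
have := count_predC (mem w) (enum 'I_k).
rewrite C size_enum_ord /std_size => {C}; set c := count _ _ => e.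
by lia.
Qed.

Lemma std_letter_lt w j : (std_letter w j < std_size w)%N.
Proof.
rewrite /std_letter /std_size.
have ln := nletters_le_n w; have lk := nletters_le_k w.
case: ifPn => [_|nj]; first by have := ltn_ord (tnth w j); lia.
have C : #|[set j : 'I_n | ~~ initial w j]| = (n - nletters w)%N.
  have -> : [set j : 'I_n | ~~ initial w j] = ~: [set j | initial w j].
    by apply/setP => i; rewrite !inE.
  by rewrite cardsCs setCK card_initial card_ord.
suff : (#|[set j' : 'I_n | (j' < j)%N && ~~ initial w j']| < n - nletters w)%N by lia.
rewrite -C; apply: proper_card; apply/properP; split.
  by apply/subsetP => i; rewrite !inE => /andP[].
by exists j; rewrite !inE ?ltnn.
Qed.

Lemma std_letter_inj w : injective (std_letter w).
Proof.
have K i j : ~~ initial w i -> ~~ initial w j -> (i < j)%N ->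
    (std_letter w i < std_letter w j)%N.
  move=> ni nj lt; rewrite /std_letter (negPf ni) (negPf nj) ltn_add2l.
  apply: proper_card; apply/properP; split.
    by apply/subsetP => l; rewrite !inE => /andP[li ->]; rewrite (ltn_trans li).
  by exists i; rewrite !inE ?lt ?ltnn.
move=> i j; case: (boolP (initial w i)) (boolP (initial w j)) => ii [] ij.
- rewrite /std_letter ii ij => /val_inj; exact: initial_inj.
- by rewrite /std_letter ii (negPf ij); have := ltn_ord (tnth w i); lia.
- by rewrite /std_letter ij (negPf ii); have := ltn_ord (tnth w j); lia.
- move=> e; apply: val_inj; case: (ltngtP i j) => // lt.
    by have := K _ _ ii ij lt; rewrite e ltnn.
  by have := K _ _ ij ii lt; rewrite e ltnn.
Qed.

Lemma std_seq_uniq w : uniq (std_seq w).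
Proof.
rewrite cat_uniq map_inj_uniq ?enum_uniq; last exact: std_letter_inj.
rewrite (map_inj_uniq val_inj) filter_uniq ?enum_uniq // andbT /=.
apply/hasPn => x /mapP[a]; rewrite mem_filter => /andP[aw _] ->.
apply/negP => /mapP[j _]; rewrite /std_letter; case: ifP => _.
  by move/val_inj => e; rewrite e mem_tnth in aw.
by have := ltn_ord a; rewrite /=; lia.
Qed.

Lemma std_seq_lt w (i : 'I_(std_size w)) : (nth 0%N (std_seq w) i < std_size w)%N.
Proof.
have : nth 0%N (std_seq w) i \in std_seq w by rewrite mem_nth // size_std_seq.
rewrite mem_cat => /orP[/mapP[j _ ->]|/mapP[a _ ->]]; first exact: std_letter_lt.
rewrite /std_size /=; have := ltn_ord a; have := nletters_le_n w; lia.
Qed.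

Lemma std_inj w : injective (fun i => Ordinal (std_seq_lt (w := w) i)).
Proof.
move=> i j [/eqP]; rewrite nth_uniq ?size_std_seq ?std_seq_uniq // => /eqP.
exact: val_inj.
Qed.

Definition std w : 'S_(std_size w) := perm (@std_inj w).

(* The positions of the occurrences of the first initial letter in increasing
   order, then those of the second one, etc. *)
Definition sigma_seq w : seq 'I_n :=
  flatten [seq [seq j <- enum 'I_n | tnth w j == a] | a <- initials w].

Lemma perm_sigma_seq w : perm_eq (sigma_seq w) (enum 'I_n).
Proof.
have H (e : seq 'I_n) (s : seq 'I_k) : uniq s -> perm_eq
    (flatten [seq [seq j <- e | tnth w j == a] | a <- s])
    [seq j <- e | tnth w j \in s].
  elim: s => [_|a s IH /= /andP[as_ us]]; first by rewrite filter_pred0.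
  have {}IH := IH us.
  rewrite perm_sym -(perm_filterC (fun j => tnth w j == a)) perm_sym.
  rewrite -!filter_predI.
  have -> : [seq j <- e | predI (fun j => tnth w j == a)
      (fun j => tnth w j \in a :: s) j] = [seq j <- e | tnth w j == a].
    by apply: eq_filter => j /=; rewrite inE; case: eqP.
  have -> : [seq j <- e | predI (predC (fun j => tnth w j == a))
      (fun j => tnth w j \in a :: s) j] = [seq j <- e | tnth w j \in s].
    by apply: eq_filter => j /=; rewrite inE; case: eqP => //= ->; apply/esym/negbTE.
  by rewrite perm_cat2l.
apply: perm_trans (H _ _ (initials_uniq w)) _.
rewrite (_ : [seq j <- _ | _] = enum 'I_n) //.
by apply/all_filterP/allP => j _; rewrite mem_initials mem_tnth.
Qed.

Lemma size_sigma_seq w : size (sigma_seq w) = n.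
Proof. by rewrite (perm_size (perm_sigma_seq w)) size_enum_ord. Qed.

Lemma sigma_inj w : injective (fun i : 'I_n => nth i (sigma_seq w) i).
Proof.
move=> i j; rewrite (set_nth_default j i) ?size_sigma_seq // => /eqP.
rewrite nth_uniq ?size_sigma_seq //; first by move/eqP/val_inj.
by rewrite (perm_uniq (perm_sigma_seq w)) enum_uniq.
Qed.

Definition sigma w : 'S_n := perm (@sigma_inj w).

Definition conv_seq w : seq 'I_k :=
  flatten [seq nseq (count_mem a w) a | a <- initials w].

Lemma conv_seqE w : conv_seq w = [seq tnth w j | j <- sigma_seq w].
Proof.
rewrite /sigma_seq map_flatten -map_comp; congr flatten; apply: eq_map => a /=.
rewrite -[in LHS](map_tnth_enum w) count_map -size_filter -(size_map (tnth w)).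
by apply/esym/all_pred1P; rewrite all_map; apply: filter_all.
Qed.

Lemma perm_conv_seq w : perm_eq (conv_seq w) w.
Proof.
by rewrite conv_seqE -[X in perm_eq _ X](map_tnth_enum w) perm_map ?perm_sigma_seq.
Qed.

Lemma size_conv_seq w : size (conv_seq w) == n.
Proof. by rewrite (perm_size (perm_conv_seq w)) size_tuple. Qed.

(* convP below: conv w is the unique word satisfying is_conv w. *)
Definition conv w : n.-tuple 'I_k := Tuple (size_conv_seq w).

Definition convex v := [forall a : 'I_n, forall b : 'I_n, forall c : 'I_n,
  (a < b < c)%N && (tnth v a == tnth v c) ==> (tnth v b == tnth v a)].

Definition is_conv w v :=
  [&& convex v, perm_eq v w & initials v == initials w].

Definition leK (s : seq 'I_k) : rel 'I_k :=
  fun a b => (index a s <= index b s)%N.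

Lemma leK_trans s : transitive (leK s).
Proof. by move=> b a c; apply: leq_trans. Qed.

Lemma leK_anti s : {in s &, antisymmetric (leK s)}.
Proof.
move=> a b ain bin; rewrite -eqn_leq => /eqP e.
by rewrite -(nth_index a ain) e nth_index.
Qed.

Lemma index_tnth_le v j : (index (tnth v j) v <= j)%N.
Proof.
rewrite -ltnS; apply: index_ltn.
rewrite (take_nth (tnth v j)) ?size_tuple // mem_rcons inE.
by rewrite -tnth_nth eqxx.
Qed.

Lemma index_initial v j : initial v j -> index (tnth v j) v = j.
Proof.
move/initialP => H; apply/eqP; rewrite eqn_leq index_tnth_le leqNgt /=.
apply/negP => lt; pose i := Ordinal (ltn_trans lt (ltn_ord j)).
by case: (H i lt); rewrite (tnth_nth (tnth v j)) /= nth_index // mem_tnth.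
Qed.

Lemma sorted_enum_initial v :
  sorted (fun i j : 'I_n => (i < j)%N) [seq j <- enum 'I_n | initial v j].
Proof.
apply: sorted_filter; first by move=> j i l; apply: ltn_trans.
by have := iota_ltn_sorted 0 n; rewrite -val_enum_ord sorted_map.
Qed.

Lemma initials_index_le v a b : a \in v -> b \in v ->
  (index a v <= index b v)%N -> leK (initials v) a b.
Proof.
move=> av bv le; rewrite /leK leqNgt; apply/negP => lt.
have T : transitive (fun x y : 'I_k => (index x v < index y v)%N).
  by move=> y x z; apply: ltn_trans.
have S : sorted (fun x y : 'I_k => (index x v < index y v)%N) (initials v).
  apply: (homo_sorted_in (P := initial v)) (sorted_enum_initial v).
    by move=> i j ii ij ltij; rewrite !index_initial.
  exact: filter_all.
have := sorted_ltn_index T S; move/(_ b a).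
by rewrite !mem_initials => /(_ bv av lt); rewrite ltnNge le.
Qed.

Lemma convex_sorted v : convex v -> sorted (leK (initials v)) v.
Proof.
move=> /forallP C; case E : (tval v) => [//|x0 s']; rewrite -E.
apply/(sortedP x0) => i; rewrite size_tuple => lti.
pose p := Ordinal (ltnW lti); pose q := Ordinal lti.
have -> : nth x0 v i = tnth v p by rewrite (tnth_nth x0).
have -> : nth x0 v i.+1 = tnth v q by rewrite (tnth_nth x0).
apply: initials_index_le; rewrite ?mem_tnth // leqNgt; apply/negP => lt.
have lp := index_tnth_le v p.
pose q0 := Ordinal (leq_ltn_trans (index_tnth_le v q) (ltn_ord q)).
have eq0 : tnth v q0 = tnth v q.
  by rewrite (tnth_nth x0) /= nth_index // mem_tnth.
have := forallP (forallP (C q0) p) q; rewrite eq0 eqxx andbT /=.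
rewrite (leq_trans lt lp) ltnSn /= => /eqP e.
by move: lt; rewrite e ltnn.
Qed.

Lemma conv_sorted w : sorted (leK (initials w)) (conv_seq w).
Proof.
rewrite sorted_pairwise; last exact: leK_trans.
suff H (l s : seq 'I_k) : uniq (l ++ s) ->
    pairwise (leK (l ++ s)) (flatten [seq nseq (count_mem a w) a | a <- s]).
  exact: (H [::] _ (initials_uniq w)).
elim: s l => [|a s IH] l // u.
have ia : index a (l ++ a :: s) = size l.
  rewrite index_cat; move: u; rewrite cat_uniq /= => /and3P[_ + _].
  by rewrite negb_or => /andP[/negPf -> _]; rewrite eqxx addn0.
rewrite [flatten _]/= pairwise_cat; apply/and3P; split.
- apply/allrelP => x y /nseqP[-> _] /flattenP[_ /mapP[b bs ->] /nseqP[-> _]].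
  rewrite /leK ia index_cat; case: ifP => [bl|_]; last exact: leq_addr.
  move: u; rewrite cat_uniq => /and3P[_ /hasPn /(_ b) + _].
  by rewrite inE bs orbT bl => /(_ isT).
- apply/(pairwiseP a) => i j; rewrite !inE size_nseq => li lj _.
  by rewrite !nth_nseq li lj /leK.
- by have := IH (rcons l a); rewrite cat_rcons; apply.
Qed.

Lemma initials_sorted s : uniq s -> sorted (leK s) s.
Proof.
case: s => [//|x0 s'] u; apply/(sortedP x0) => i lt.
by rewrite /leK !index_uniq // ltnW.
Qed.

Lemma initials_conv w : initials (conv w) = initials w.
Proof.
have sub : {subset initials (conv w) <= initials w}.
  by move=> a; rewrite !mem_initials (perm_mem (perm_conv_seq w)).
apply: (@sorted_eq_in _ (leK (initials w))).
- by move=> b a c _ _ _; apply: leK_trans.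
- by move=> a b /sub ha /sub hb; apply: leK_anti.
- apply: (subseq_sorted (@leK_trans (initials w))) (conv_sorted w).
  rewrite -[X in subseq _ X](map_tnth_enum (conv w)).
  exact/map_subseq/filter_subseq.
- exact/initials_sorted/initials_uniq.
- apply: uniq_perm; rewrite ?initials_uniq // => a.
  by rewrite !mem_initials (perm_mem (perm_conv_seq w)).
Qed.

Lemma convex_conv w : convex (conv w).
Proof.
apply/forallP => a; apply/forallP => b; apply/forallP => c.
apply/implyP => /andP[/andP[ab bc] /eqP e].
have I x : tnth (conv w) x \in initials w.
  by rewrite mem_initials -(perm_mem (perm_conv_seq w)) mem_tnth.
have L (x y : 'I_n) : (x < y)%N ->
    leK (initials w) (tnth (conv w) x) (tnth (conv w) y).
  move=> xy; have x0 := tnth w x; rewrite !(tnth_nth x0).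
  apply: (sorted_ltn_nth (@leK_trans (initials w))) => //; first exact: conv_sorted.
  - by rewrite inE size_tuple.
  - by rewrite inE size_tuple.
apply/eqP/(@leK_anti (initials w)) => //; apply/andP; split; last exact: L.
by rewrite e; apply: L.
Qed.

Lemma convP w v : is_conv w v = (v == conv w).
Proof.
apply/idP/eqP => [/and3P[cv pvw /eqP iv]|->]; last first.
  by rewrite /is_conv convex_conv perm_conv_seq initials_conv eqxx.
have sub : {subset v <= initials w} by move=> a; rewrite mem_initials (perm_mem pvw).
apply/val_inj/(@sorted_eq_in _ (leK (initials w))).
- by move=> b a c _ _ _; apply: leK_trans.
- by move=> a b /sub ha /sub hb; apply: leK_anti.
- by rewrite -iv; apply: convex_sorted.
- exact: conv_sorted.
- by rewrite (permPl pvw) perm_sym perm_conv_seq.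
Qed.

End Words.

Section WidenPerm.
Variables (n m : nat) (le_nm : (n <= m)%N) (s : 'S_n).

Let ext (i : 'I_m) : 'I_m :=
  if insub (val i) is Some j then widen_ord le_nm (s j) else i.

Fact widen_perm_subproof : injective ext.
Proof.
move=> i j; rewrite /ext; case: insubP => [a _ ai|ni];
  case: insubP => [b _ bj|nj] //.
- move/(congr1 val) => /= /val_inj/perm_inj ab.
  by apply: val_inj; rewrite -ai -bj ab.
- by move/(congr1 val) => /= e; move: nj; rewrite /= -e ltn_ord.
- by move/(congr1 val) => /= e; move: ni; rewrite /= e ltn_ord.
Qed.

(* S_n as the subgroup of S_m fixing the last m - n points. *)
Definition widen_perm : 'S_m := perm widen_perm_subproof.

End WidenPerm.

Definition word_schubert (n k : nat) (w : n.-tuple 'I_k) :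
    {mpoly int[std_size (conv w)]} :=
  msym (widen_perm (leq_std_size (conv w)) (sigma w)^-1%g)
    (schubert (std (conv w))).

Definition widen_mpoly (n m : nat) (le_nm : (n <= m)%N) (f : {mpoly int[n]}) :
    {mpoly int[m]} :=
  f \mPo [tuple 'X_(widen_ord le_nm i) | i < n].

(* Equality in Z[x_1, x_2, ...] of polynomials in possibly different numbers
   of variables. *)
Definition eq_mpoly (n m : nat) (f : {mpoly int[n]}) (g : {mpoly int[m]}) :=
  widen_mpoly (leq_maxl n m) f = widen_mpoly (leq_maxr n m) g.

Section Star.
Variables (n k : nat) (n_gt0 : (0 < n)%N) (w : n.-tuple 'I_k).

Definition last_initial : 'I_n :=
  [arg max_(i > Ordinal n_gt0 | initial w i) nat_of_ord i]%N.

Lemma last_initialP :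
  initial w last_initial /\ forall j, initial w j -> (j <= last_initial)%N.
Proof.
rewrite /last_initial; case: arg_maxnP => [|i ii max]; first exact/initialP.
by split.
Qed.

Definition star1 : n.+1.-tuple 'I_k := [tuple of rcons w (tnth w last_initial)].

Lemma star1_fubini : w \in fubini n k -> star1 \in fubini n.+1 k.
Proof.
rewrite !inE => /forallP wk; apply/forallP => a.
by rewrite mem_rcons inE wk orbT.
Qed.

End Star.

(* Main.v *)
Require Import Defs.
From HB Require Import structures.
From mathcomp Require Import all_boot all_order all_fingroup all_algebra.
From mathcomp Require Import zify.
From mathcomp.multinomials Require Import mpoly.

(** The letter appended to [w] is the last letter of [conv w], so [conv] of the
    new word is [conv w] with its last letter repeated, and both [sigma] and
    [std \o conv] are extended by a fixed point.  The statement is thus the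
    stability of Schubert polynomials under the inclusion of [S_N] in
    [S_(N+1)].  Divided differences commute with this inclusion, which reduces
    stability to [p = w0]; there, moving the value [N] from the first position
    of the longest element of [S_(N+1)] to the last one divides the staircase
    monomial successively by [x_1], ..., [x_N]. *)

Set Implicit Arguments.
Unset Strict Implicit.
Unset Printing Implicit Defensive.

Import GRing.Theory.
Local Open Scope ring_scope.

(** * Adding variables *)

(** Integer scalars are iterated sums, so every ring morphism respects them and only the images of
    the variables matter. *)
Lemma mpoly_rmorph_ext (n : nat) (S : comNzRingType)
    (f g : {rmorphism {mpoly int[n]} -> S}) :
  (forall i, f 'X_i = g 'X_i) -> f =1 g.
Proof.
move=> fg; elim/mpolyind => [|c m p _ _ IH]; first by rewrite !rmorph0.
rewrite !rmorphD IH -[c]intz scaler_int !rmorphMz; congr (_ *~ _ + _).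
rewrite mpolyXE_id !rmorph_prod; apply: eq_bigr => i _.
by rewrite !rmorphXn; congr (_ ^+ _); apply: fg.
Qed.

HB.instance Definition _ n m le_nm :=
  GRing.RMorphism.copy (@widen_mpoly n m le_nm)
    (comp_mpoly [tuple 'X_(widen_ord le_nm i) | i < n]).

Lemma widen_mpolyXU (n m : nat) (le_nm : (n <= m)%N) (i : 'I_n) :
  widen_mpoly le_nm 'X_i = 'X_(widen_ord le_nm i).
Proof. by rewrite /widen_mpoly comp_mpolyXU -tnth_nth tnth_mktuple. Qed.

Lemma widen_mpoly_trans (n m l : nat) (le_nm : (n <= m)%N) (le_ml : (m <= l)%N)
    (le_nl : (n <= l)%N) (f : {mpoly int[n]}) :
  widen_mpoly le_ml (widen_mpoly le_nm f) = widen_mpoly le_nl f.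
Proof.
apply: (mpoly_rmorph_ext (f := widen_mpoly le_ml \o widen_mpoly le_nm)
  (g := widen_mpoly le_nl)) => i /=.
by rewrite !widen_mpolyXU; congr 'X_(_); apply: val_inj.
Qed.

Lemma msym_widen_mpoly (n m : nat) (le_nm : (n <= m)%N) (s : 'S_n) (t : 'S_m)
    (f : {mpoly int[n]}) :
  (forall i, t (widen_ord le_nm i) = widen_ord le_nm (s i)) ->
  msym t (widen_mpoly le_nm f) = widen_mpoly le_nm (msym s f).
Proof.
move=> ts; apply: (mpoly_rmorph_ext (f := msym t \o widen_mpoly le_nm)
  (g := widen_mpoly le_nm \o msym s)) => i /=.
by rewrite widen_mpolyXU !msymXU widen_mpolyXU ts.
Qed.

Lemma widen_tperm (n m : nat) (le_nm : (n <= m)%N) (i j l : 'I_n) :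
  tperm (widen_ord le_nm i) (widen_ord le_nm j) (widen_ord le_nm l) =
  widen_ord le_nm (tperm i j l).
Proof. by apply/esym/inj_tperm => x y /(congr1 val) /= /val_inj. Qed.

(** The widened quotient satisfies the equation that characterizes the quotient in the larger
    ring. *)
Lemma widen_ddiff (n m : nat) (le_nm : (n <= m)%N) (i j : 'I_n)
    (f : {mpoly int[n]}) : i != j ->
  ddiff (widen_ord le_nm i) (widen_ord le_nm j) (widen_mpoly le_nm f) =
  widen_mpoly le_nm (ddiff i j f).
Proof.
move=> ij; apply/esym/ddiff_uniq; first by rewrite -val_eqE.
rewrite (msym_widen_mpoly (s := tperm i j)); last exact: widen_tperm.
by rewrite -rmorphB -ddiffP rmorphM rmorphB /= !widen_mpolyXU.
Qed.

(** * Stability of Schubert polynomials *)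

(** Values drop by at least one at each step. Counting from the first position bounds [p i] above,
    counting from the last bounds it below, and both bounds are N - 1 - i. *)
Lemma no_ascent_w0 (N : nat) (p : 'S_N) :
  (forall ij, ascent p ij = false) -> p = w0 N.
Proof.
move=> np.
have desc (i j : 'I_N) : j = i.+1 :> nat -> (p j < p i)%N.
  move=> ij; have := np (i, j); rewrite /ascent /= ij eqxx /= ltnNge => /negbFE.
  rewrite leq_eqVlt => /orP[/eqP/val_inj/perm_inj ji|//].
  by move: ij; rewrite ji; lia.
have ub d (i : 'I_N) : i = d :> nat -> (p i + i < N)%N.
  elim: d i => [|d IH] i id; first by have := ltn_ord (p i); lia.
  have lt : (d < N)%N by have := ltn_ord i; lia.
  by have := IH (Ordinal lt) erefl; have := desc (Ordinal lt) i id; rewrite /=; lia.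
have lb d (i : 'I_N) : (i + d.+1 = N)%N -> (d <= p i)%N.
  elim: d i => [|d IH] i id //.
  have lt : (i.+1 < N)%N by lia.
  have /= := IH (Ordinal lt); have := desc i (Ordinal lt) erefl.
  by move=> + IH'; have := IH' ltac:(lia); lia.
apply/permP => i; apply: val_inj; rewrite w0E /=.
have := ub i i erefl; have := lb (N - i.+1)%N i; have := ltn_ord i.
by lia.
Qed.

(** In one-line notation q is the longest element of S_(N+1) with its maximum N moved from position
    0 to position t. The monomial is the staircase divided by the variables of index less than t. *)
Lemma schubert_w0_insert (N t : nat) (q : 'S_N.+1) : (t <= N)%N ->
  (forall i : 'I_N.+1,
    q i = (if i < t then N.-1 - i else if i == t :> nat then N else N - i)%N
      :> nat) ->
  schubert q = \prod_(i < N.+1) 'X_i ^+ (N - i - (i < t))%N.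
Proof.
elim: t q => [|t IH] q le_tN qE.
  have -> : q = w0 N.+1.
    apply/permP => i; apply: val_inj; rewrite /= qE w0E /=.
    by case: eqP => [->|_]; lia.
  by rewrite schubert_w0 /staircase; apply: eq_bigr => i _; rewrite subn0.
have lti : (t < N.+1)%N by lia.
(* The maximum now sits at j; swapping i and j moves it back to t, the case covered by induction. *)
pose i := Ordinal lti; pose j := Ordinal (le_tN : (t.+1 < N.+1)%N).
have ij : i != j by rewrite -val_eqE /=; lia.
have asc : ascent q (i, j).
  by rewrite /ascent /= !qE /= ltnSn eqxx ltnn; lia.
rewrite (schubert_asc asc) (IH _ (ltnW le_tN)); last first.
  move=> l; rewrite permM.
  have V (x y : 'I_N.+1) : x <> y -> nat_of_ord x <> y by move=> xy /val_inj.
  by case: tpermP => [->|->|/V /= li /V /= lj]; rewrite qE /=;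
    do ?case: ifP => ?; lia.
(* The monomial for t is x_t g, and g has the same exponent N - t - 1 in x_t and x_(t+1). So the
   swap fixes g, and the difference quotient of x_t g is g. *)
set g := (RHS).
have gE : \prod_(l < N.+1) 'X_l ^+ (N - l - (l < t))%N = 'X_i * g.
  rewrite /g (bigD1 i) //= [in RHS](bigD1 i) //= mulrA -exprS; congr (_ ^+ _ * _).
    by lia.
  apply: eq_bigr => l; rewrite -val_eqE /= => li; congr (_ ^+ (_ - _)).
  by lia.
have gs : msym (tperm i j) g = g.
  rewrite /g rmorph_prod /= [RHS](reindex_inj (@perm_inj _ (tperm i j))) /=.
  apply: eq_bigr => l _; rewrite rmorphXn /= msymXU; congr (_ ^+ _).
  have V (x y : 'I_N.+1) : x <> y -> nat_of_ord x <> y by move=> xy /val_inj.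
  case: tpermP => [->|->|_ _] //=; lia.
apply/esym/ddiff_uniq => //.
by rewrite gE msymM msymXU tpermL gs mulrBl.
Qed.

(** The first N positions already take all values below N, so injectivity leaves only N for the last
    one. *)
Lemma extend_perm_last (N : nat) (p : 'S_N) (q : 'S_N.+1) :
  (forall i, q (widen_ord (leqnSn N) i) = widen_ord (leqnSn N) (p i)) ->
  q ord_max = ord_max.
Proof.
move=> qp; apply/val_inj/eqP; rewrite /= eqn_leq -ltnS ltn_ord leqNgt.
apply/negP => lt; pose y := Ordinal lt.
have /perm_inj/(congr1 val) /= e : q (widen_ord (leqnSn N) (p^-1%g y)) = q ord_max.
  by rewrite qp permKV; apply: val_inj.
by have := ltn_ord (p^-1%g y); rewrite [X in (X < _)%N]e ltnn.
Qed.

(** Induction on the number of noninversions of p: swapping an ascent of p in both p and q preserves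
    the hypothesis. *)
Lemma schubert_stable (N : nat) (p : 'S_N) (q : 'S_N.+1) :
  (forall i, q (widen_ord (leqnSn N) i) = widen_ord (leqnSn N) (p i)) ->
  schubert q = widen_mpoly (leqnSn N) (schubert p).
Proof.
have [m] := ubnP #|noninv p|; elim: m p q => // m IH p q ltm qp.
case: (pickP (ascent p)) => [[i j] aij|np].
  have [/= /eqP ij pij] := andP aij.
  have aq : ascent q (widen_ord (leqnSn N) i, widen_ord (leqnSn N) j).
    by rewrite /ascent /= !qp /= ij eqxx.
  rewrite (schubert_asc aq) (schubert_asc aij) -widen_ddiff; last first.
    by rewrite -val_eqE /= ij; lia.
  congr (ddiff _ _ _); apply: IH; first exact: leq_trans (card_noninv_lt aij) ltm.
  by move=> l; rewrite !permM widen_tperm qp.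
have pw := no_ascent_w0 np.
(* Here q is N-1, ..., 0, N, the insertion with t = N. The exponents become N - i - 1 for i < N and
   0 for the last variable, which is the staircase of S_N. *)
rewrite (@schubert_w0_insert N N) //; last first.
  move=> i; case: (ltnP i N) => [lt|ge].
    have -> : i = widen_ord (leqnSn N) (Ordinal lt) by apply: val_inj.
    by rewrite qp pw w0E /=; lia.
  have -> : i = ord_max by apply: val_inj; rewrite /=; have := ltn_ord i; lia.
  by rewrite (extend_perm_last qp) /= eqxx.
rewrite pw schubert_w0 /staircase rmorph_prod big_ord_recr /=.
rewrite ltnn subnn expr0 mulr1.
apply: eq_bigr => i _; rewrite rmorphXn /= widen_mpolyXU ltn_ord; congr (_ ^+ _).
by lia.
Qed.

(** The sizes [std_size] of the two words equal n and n + 1 only propositionally, so N' is tied to N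
    by an equation and permutations are compared through the numerical values of indices. *)
Lemma eq_msym_schubert (N N' : nat) (p s : 'S_N) (q t : 'S_N') : N' = N.+1 ->
  (forall (i : 'I_N) (j : 'I_N'), i = j :> nat -> p i = q j :> nat) ->
  (forall (i : 'I_N) (j : 'I_N'), i = j :> nat -> s i = t j :> nat) ->
  eq_mpoly (msym t (schubert q)) (msym s (schubert p)).
Proof.
move=> eN; subst N' => pq st; rewrite /eq_mpoly (@schubert_stable _ p); last first.
  by move=> i; apply: val_inj; rewrite /= -(pq i).
rewrite (msym_widen_mpoly (s := s)); last first.
  by move=> i; apply: val_inj; rewrite /= -(st i).
exact: widen_mpoly_trans.
Qed.

Lemma widen_permE (n m : nat) (le_nm : (n <= m)%N) (s : 'S_n) (i : 'I_m) (j : 'I_n) :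
  i = j :> nat -> widen_perm le_nm s i = s j :> nat.
Proof.
move=> ij; rewrite permE; case: insubP => [a _ ai|/negP[]]; last by rewrite /= ij.
by congr (val (s _)); apply: val_inj; rewrite [LHS]ai.
Qed.

(** * Words *)

Lemma nletters_fubini (n k : nat) (w : n.-tuple 'I_k) :
  w \in fubini n k -> nletters w = k.
Proof.
rewrite inE => /forallP wk; rewrite /nletters -(card_uniqP (undup_uniq w)).
rewrite -[RHS]card_ord; apply: eq_card => a; rewrite mem_undup wk.
by [].
Qed.

Lemma conv_fubini (n k : nat) (w : n.-tuple 'I_k) :
  w \in fubini n k -> conv w \in fubini n k.
Proof.
rewrite !inE => /forallP wk; apply/forallP => a.
by rewrite (perm_mem (perm_conv_seq w)).
Qed.

Lemma stdE (n k : nat) (w : n.-tuple 'I_k) (i : 'I_(std_size w)) (j : 'I_n) :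
  i = j :> nat -> std w i = std_letter w j :> nat.
Proof.
move=> ij; rewrite permE /= /std_seq nth_cat size_map size_enum_ord ij.
by rewrite ltn_ord (nth_map j) ?size_enum_ord // nth_ord_enum.
Qed.

Lemma sigmaE (n k : nat) (w : n.-tuple 'I_k) (x0 i : 'I_n) :
  sigma w i = nth x0 (sigma_seq w) i.
Proof. by rewrite permE; apply: set_nth_default; rewrite size_sigma_seq. Qed.

(** * Appending a letter that already occurs *)

Section Rcons.
Variables (n k : nat) (w : n.-tuple 'I_k) (w' : n.+1.-tuple 'I_k) (b : 'I_k).
Hypotheses (w'E : w' = rcons w b :> seq _) (bw : b \in w).

Let wid : 'I_n -> 'I_n.+1 := widen_ord (leqnSn n).

Lemma tnth_rcons_widen j : tnth w' (wid j) = tnth w j.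
Proof. by rewrite !(tnth_nth b) w'E nth_rcons size_tuple /= ltn_ord. Qed.

Lemma tnth_rcons_max : tnth w' ord_max = b.
Proof. by rewrite (tnth_nth b) w'E nth_rcons size_tuple /= ltnn eqxx. Qed.

Lemma initial_rcons_widen j : initial w' (wid j) = initial w j.
Proof.
apply/initialP/initialP => H i lt.
  by have := H (wid i) lt; rewrite !tnth_rcons_widen.
have lt' : (i < n)%N := ltn_trans lt (ltn_ord j).
have -> : i = wid (Ordinal lt') by apply: val_inj.
by rewrite !tnth_rcons_widen; apply: H.
Qed.

Lemma initial_rcons_max : initial w' ord_max = false.
Proof.
apply/negP => /initialP H; have /tnthP[j bj] := bw.
by apply: (H (wid j)) => //=; rewrite tnth_rcons_widen tnth_rcons_max.
Qed.

(** A standardized letter depends only on the positions up to its own. *)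
Lemma std_letter_rcons_widen j : std_letter w' (wid j) = std_letter w j.
Proof.
rewrite /std_letter initial_rcons_widen tnth_rcons_widen; case: ifP => // _.
congr (_ + _)%N.
have wid_inj : injective wid by move=> x y /(congr1 val) /= /val_inj.
rewrite -(card_imset _ wid_inj); apply: eq_card => i; rewrite !inE.
apply/andP/imsetP => [[lt ni]|[l]].
  have lt' : (i < n)%N := ltn_trans lt (ltn_ord j).
  have e : i = wid (Ordinal lt') by apply: val_inj.
  by exists (Ordinal lt') => //; rewrite inE lt /= -initial_rcons_widen -e.
by rewrite inE => /andP[lt nl] ->; rewrite initial_rcons_widen.
Qed.

Lemma initials_rcons : initials w' = initials w.
Proof.
rewrite /initials enum_ordSr filter_rcons initial_rcons_max filter_map -map_comp.
rewrite (eq_filter (a2 := initial w)); last exact: initial_rcons_widen.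
by apply: eq_map; apply: tnth_rcons_widen.
Qed.

Lemma std_rcons (i : 'I_(std_size w)) (j : 'I_(std_size w')) :
  w \in fubini n k -> i = j :> nat -> std w i = std w' j :> nat.
Proof.
(* Since no letter is missing from w, [std w] has size n and nothing is appended to the standardized
   letters. *)
move=> wk ij; have lt : (i < n)%N.
  by have := ltn_ord i; rewrite {2}/std_size (nletters_fubini wk) addnK.
rewrite (@stdE _ _ w i (Ordinal lt)) // (@stdE _ _ w' j (wid (Ordinal lt))) //.
by rewrite std_letter_rcons_widen.
Qed.

(** As b is the last initial letter, its block of positions closes the list, and the new position is
    the largest of that block. *)
Lemma sigma_seq_rcons (s : seq 'I_k) : initials w = rcons s b ->
  sigma_seq w' = rcons (map wid (sigma_seq w)) ord_max.
Proof.
move=> iw; rewrite /sigma_seq initials_rcons iw !map_rcons !flatten_rcons.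
have F a : [seq j <- enum 'I_n.+1 | tnth w' j == a] =
    map wid [seq j <- enum 'I_n | tnth w j == a] ++ nseq (b == a) ord_max.
  rewrite enum_ordSr filter_rcons tnth_rcons_max filter_map.
  rewrite (eq_filter (a2 := fun j => tnth w j == a)); last first.
    by move=> j /=; rewrite tnth_rcons_widen.
  by case: eqP => _; rewrite ?cats1 ?cats0.
rewrite F eqxx map_cat -cats1 -catA; congr (_ ++ _).
rewrite map_flatten -map_comp; congr flatten; apply/eq_in_map => a as_ /=.
rewrite F; case: eqP => [ba|_]; last by rewrite cats0.
(* The blocks of the letters in s do not change, because initial letters are distinct and so b is
   not in s. *)
by have := initials_uniq w; rewrite iw rcons_uniq ba as_.
Qed.

Lemma conv_seq_rcons (s : seq 'I_k) : initials w = rcons s b ->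
  conv_seq w' = rcons (conv_seq w) b.
Proof.
move=> iw; rewrite !conv_seqE (sigma_seq_rcons iw) map_rcons tnth_rcons_max.
by rewrite -map_comp; congr rcons; apply: eq_map; apply: tnth_rcons_widen.
Qed.

Lemma sigma_rcons (s : seq 'I_k) j : initials w = rcons s b ->
  sigma w' (wid j) = wid (sigma w j).
Proof.
move=> iw; rewrite (sigmaE w' ord_max) (sigmaE w j) (sigma_seq_rcons iw).
by rewrite nth_rcons size_map size_sigma_seq /= ltn_ord (nth_map j) ?size_sigma_seq.
Qed.

End Rcons.

Lemma initials_last (n k : nat) (n_gt0 : (0 < n)%N) (w : n.-tuple 'I_k) :
  exists s, initials w = rcons s (tnth w (last_initial n_gt0 w)).
Proof.
have [il max] := last_initialP n_gt0 w; move: il max.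
set l := last_initial n_gt0 w => il max; rewrite /initials.
have : l \in [seq j <- enum 'I_n | initial w j] by rewrite mem_filter il mem_enum.
have := sorted_enum_initial w; have := filter_all (initial w) (enum 'I_n).
(* Initial positions are listed increasingly, so an entry x after l would be an initial position
   beyond the largest one. *)
move=> + + lin; case/splitPr: lin => s1 [|x s2]; last first.
  rewrite all_cat /= => /and4P[_ _ /max xl _].
  by case/cat_sorted2 => _ /= /andP[]; rewrite ltnNge xl.
by move=> _ _; exists (map (tnth w) s1); rewrite cats1 map_rcons.
Qed.

Theorem theorem7p1 (n k : nat) (k_gt0 : (0 < k)%N) (le_kn : (k <= n)%N)
    (w : n.-tuple 'I_k) (w_fubini : w \in fubini n k) :
  eq_mpoly (word_schubert (star1 (leq_trans k_gt0 le_kn) w)) (word_schubert w).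
Proof.
set n_gt0 := leq_trans _ _; set b := tnth w (last_initial n_gt0 w).
set w' := star1 n_gt0 w.
have [s iw] := initials_last n_gt0 w.
have w'E : w' = rcons w b :> seq _ by [].
have bw : b \in w by apply: mem_tnth.
(* The results on appended letters serve twice: for w and w' they give [conv] and [sigma], and for
   their images under [conv] they give [std]. *)
have cE : conv w' = rcons (conv w) b :> seq _ := conv_seq_rcons w'E bw iw.
have cb : b \in conv w by rewrite (perm_mem (perm_conv_seq w)).
have ck := conv_fubini w_fubini.
have ck' := conv_fubini (star1_fubini n_gt0 w_fubini).
have sz : std_size (conv w) = n by rewrite /std_size nletters_fubini // addnK.
have sz' : std_size (conv w') = n.+1.
  by rewrite /std_size nletters_fubini // addnK.
apply: eq_msym_schubert => [|i j|i j ij]; first by rewrite sz sz'.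
  exact: (@std_rcons _ _ _ _ b cE).
(* As [std_size (conv w)] is n, the index i is a position of w, and each widened permutation acts on
   it as the inverse of [sigma] itself. *)
have lt : (i < n)%N by apply: leq_trans (ltn_ord i) _; rewrite sz.
rewrite (@widen_permE _ _ _ _ i (Ordinal lt)) //.
rewrite (@widen_permE _ _ _ _ j (widen_ord (leqnSn n) (Ordinal lt))) //.
suff -> : (sigma w')^-1%g (widen_ord (leqnSn n) (Ordinal lt)) =
  widen_ord (leqnSn n) ((sigma w)^-1%g (Ordinal lt)) by [].
by apply: (@perm_inj _ (sigma w')); rewrite permKV (sigma_rcons w'E bw _ iw) permKV.
Qed.
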